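(* Let $[G^{ab}]$ be the symmetric matrix defined by $G^{ab}=g^{ij}C^a_iC^b_j$, let $[G_{ab}]=[G^{ab}]^{-1}$ be its inverse, and let $C^{ai}=g^{ij}C^a_j$. If the constraints are ideal, then the Lagrangian multipliers $\lambda_a$ and the Lagrangian reactive forces $R^i=g^{ij}\lambda_aC^a_j$ are well determined functions of $(q,\dot q)$: $$\lambda_a(q,\dot q)=G_{ab}\left(C^b_i\,(\Gamma^i_{hk}\dot q^h\dot q^k-A^i)-\dot q^i\,\partial_iC^b\right),$$ $$R^i(q,\dot q)=G_{ab}\,C^{ai}\left(C^b_j\,(\Gamma^j_{hk}\dot q^h\dot q^k-A^j)-\dot q^j\,\partial_jC^b\right).$$
   Context: Repeated indices are summed; $h,i,j,k\in\{1,\dots,n\}$, $a,b\in\{1,\dots,r\}$. All data are smooth. $Q$ is the $n$-dimensional configuration manifold of a mechanical system with local coordinates $q=(q^i)$; $TQ$ has coordinates $(q,\dot q)$. The kinetic energy is $K=\tfrac12g_{ij}(q)\dot q^i\dot q^j$ with $[g_{ij}]$ positive definite, $[g^{ij}]=[g_{ij}]^{-1}$, $\partial_i=\partial/\partial q^i$, and $\Gamma^i_{hk}$ are the Christoffel symbols of the Levi-Civita connection of $g_{ij}$. $A_i(q,\dot q)$ are the given Lagrangian active forces, $A^i=g^{ij}A_j$. The constraint is a regular submanifold $C\subset TQ$ represented by $r<n$ independent equations $C^a(q,\dot q)=0$, with $C^a_i=\partial C^a/\partial\dot q^i$ and $[C^a_i]$ of rank $r$. The constraints being ideal means that the Lagrangian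 reactive forces have the form $R_i=\lambda_aC^a_i$ with a priori unknown Lagrangian multipliers $\lambda_a$. The Lagrange equations $\frac{d}{dt}\frac{\partial K}{\partial\dot q^i}-\frac{\partial K}{\partial q^i}=A_i+R_i$ are then equivalent to the first-order system on $TQ$ associated with the vector field $$\mathbf X_\lambda=\dot q^i\frac{\partial}{\partial q^i}+\left(-\Gamma^i_{hk}\dot q^h\dot q^k+A^i+R^i\right)\frac{\partial}{\partial\dot q^i},\qquad R^i=g^{ij}\lambda_aC^a_j .$$ The reactive forces are such that the constraints are satisfied, i.e. $\mathbf X_\lambda$ is tangent to $C$, which is expressed by $\langle\mathbf X_\lambda,dC^a\rangle=0$ for all $a$ (to be satisfied at least on $C$). *)

(* Defs.v *)
From HB Require Import structures.
From mathcomp Require Import all_boot all_order all_algebra.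
From mathcomp Require Import all_classical all_reals all_analysis.

Set Implicit Arguments.
Unset Strict Implicit.
Unset Printing Implicit Defensive.

Import Order.TTheory GRing.Theory Num.Theory.
Import numFieldNormedType.Exports.

Local Open Scope classical_set_scope.
Local Open Scope ring_scope.

(* Everything is written in a chart of Q: a point of TQ is a pair
   p = (q, qdot), with q = p.1 and qdot = p.2 row vectors of coordinates. *)
Notation TQ R n := ('rV[R]_n * 'rV[R]_n)%type.

(* Differentiability at each order is Frechet differentiability. Between
   finite-dimensional spaces, df is of class C^k iff all the maps D_v f are, so
   this is the usual class C^k on an open set. *)
Fixpoint Ck_on (R : realType) (V : normedModType R) (k : nat)
    (D : set V) (f : V -> R) : Prop :=
  match k with
  | 0 => forall x, D x -> {for x, continuous f}
  | k'.+1 => (forall x, D x -> differentiable f x) /\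
             (forall v : V, Ck_on k' D (fun x => 'D_v f x))
  end.

Definition smooth_on (R : realType) (V : normedModType R)
  (D : set V) (f : V -> R) : Prop := forall k, Ck_on k D f.

Definition metric_on (R : realType) (n : nat) (U : set 'rV[R]_n)
    (g : 'rV[R]_n -> 'M[R]_n) : Prop :=
  [/\ forall i j, smooth_on U (fun q => g q i j),
      forall q, U q -> (g q)^T = g q &
      forall q, U q -> forall x : 'rV[R]_n, x != 0 ->
        0 < \sum_i \sum_j g q i j * x 0 i * x 0 j].

(* g^{ij} *)
Definition ginv (R : realType) (n : nat) (g : 'rV[R]_n -> 'M[R]_n)
  (q : 'rV[R]_n) (i j : 'I_n) : R := invmx (g q) i j.

(* d_h g_{jk} *)
Definition dmetric (R : realType) (n : nat) (g : 'rV[R]_n -> 'M[R]_n)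
    (q : 'rV[R]_n) (h j k : 'I_n) : R :=
  'D_(delta_mx 0 h) (fun q' => g q' j k) q.

(* Gamma^i_{hk} *)
Definition christoffel (R : realType) (n : nat) (g : 'rV[R]_n -> 'M[R]_n)
    (q : 'rV[R]_n) (i h k : 'I_n) : R :=
  2^-1 * \sum_l ginv g q i l *
    (dmetric g q h l k + dmetric g q k l h - dmetric g q l h k).

Definition christoffel_quad (R : realType) (n : nat) (g : 'rV[R]_n -> 'M[R]_n)
    (p : TQ R n) (i : 'I_n) : R :=
  \sum_h \sum_k christoffel g p.1 i h k * p.2 0 h * p.2 0 k.

(* d f / d q^i *)
Definition partial_q (R : realType) (n : nat) (f : TQ R n -> R)
  (i : 'I_n) (p : TQ R n) : R := 'D_((delta_mx 0 i, 0) : TQ R n) f p.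

(* d f / d qdot^i *)
Definition partial_qdot (R : realType) (n : nat) (f : TQ R n -> R)
  (i : 'I_n) (p : TQ R n) : R := 'D_((0, delta_mx 0 i) : TQ R n) f p.

(* C^a_i = d C^a / d qdot^i *)
Definition Cmx (R : realType) (n r : nat) (C : 'I_r -> TQ R n -> R)
  (p : TQ R n) : 'M[R]_(r, n) := \matrix_(a, i) partial_qdot (C a) i p.

Definition constraint_set (R : realType) (n r : nat) (D : set (TQ R n))
    (C : 'I_r -> TQ R n -> R) : set (TQ R n) :=
  [set p | D p /\ forall a, C a p = 0].

(* F^i = g^{ij} F_j *)
Definition raise (R : realType) (n : nat) (g : 'rV[R]_n -> 'M[R]_n)
    (F : 'I_n -> TQ R n -> R) (i : 'I_n) (p : TQ R n) : R :=
  \sum_j ginv g p.1 i j * F j p.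

(* The covariant reactive forces F_i are lambda_a C^a_i at the points of W. *)
Definition ideal_on (R : realType) (n r : nat) (W : set (TQ R n))
    (C : 'I_r -> TQ R n -> R) (lambda : 'I_r -> TQ R n -> R)
    (F : 'I_n -> TQ R n -> R) : Prop :=
  forall p, W p -> forall i, F i p = \sum_a lambda a p * Cmx C p a i.

(* The vector field of the Lagrange equations with active forces A_i and
   reactive forces F_i, as the pair of its d/dq and d/dqdot components. *)
Definition dyn_field (R : realType) (n : nat) (g : 'rV[R]_n -> 'M[R]_n)
    (A F : 'I_n -> TQ R n -> R) (p : TQ R n) : TQ R n :=
  (p.2, \row_i (- christoffel_quad g p i + raise g A i p + raise g F i p)).

(* <X, dC^a> = 0 for all a, at the points of W *)
Definition tangent_on (R : realType) (n r : nat) (W : set (TQ R n))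
    (C : 'I_r -> TQ R n -> R) (X : TQ R n -> TQ R n) : Prop :=
  forall p, W p -> forall a, 'd (C a) p (X p) = 0.

(* G^{ab} = g^{ij} C^a_i C^b_j *)
Definition Gup (R : realType) (n r : nat) (g : 'rV[R]_n -> 'M[R]_n)
    (C : 'I_r -> TQ R n -> R) (p : TQ R n) : 'M[R]_r :=
  \matrix_(a, b) \sum_i \sum_j ginv g p.1 i j * Cmx C p a i * Cmx C p b j.

(* G_{ab} *)
Definition Gdown (R : realType) (n r : nat) (g : 'rV[R]_n -> 'M[R]_n)
    (C : 'I_r -> TQ R n -> R) (p : TQ R n) : 'M[R]_r := invmx (Gup g C p).

(* C^{ai} = g^{ij} C^a_j *)
Definition Craised (R : realType) (n r : nat) (g : 'rV[R]_n -> 'M[R]_n)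
    (C : 'I_r -> TQ R n -> R) (p : TQ R n) (a : 'I_r) (i : 'I_n) : R :=
  \sum_j ginv g p.1 i j * Cmx C p a j.

(* Main.v *)
Require Import Defs.
From HB Require Import structures.
From mathcomp Require Import all_boot all_order all_algebra.
From mathcomp Require Import ring.
From mathcomp Require Import all_classical all_reals all_analysis.

(** The tangency equations are affine in the multipliers.  In a chart,
    the derivative of a constraint along the dynamical vector field is its
    q-gradient paired with the velocity plus its velocity gradient paired with
    the acceleration ([diff_chart]).  The acceleration
    splits into a part free of the multipliers and the raised reactive force,
    which for ideal constraints is g^-1 M^T lambda with M = [C^a_i]
    ([raise_ideal]).  Hence tangency at a point is the square linear system

      (M g^-1 M^T) lambda = M (Gamma - A) - dC/dq (dq/dt)

    ([tangent_at_linear]), whose matrix is G.  It has a unique solution: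
    g^-1 is symmetric positive definite because g is, and so is its pull-back
    G along the injective map M^T, the rows of M being independent
    ([posdef_invmx], [posdef_congr]); a positive definite matrix is invertible
    ([posdef_unitmx]).  The formula for the reactive force is this solution
    multiplied by g^-1 M^T. *)

Set Implicit Arguments.
Unset Strict Implicit.
Unset Printing Implicit Defensive.

Import Order.TTheory GRing.Theory Num.Theory.
Import numFieldNormedType.Exports.

Local Open Scope classical_set_scope.
Local Open Scope ring_scope.

(** * Symmetric positive definite matrices *)

Definition posdefmx (R : realType) (n : nat) (S : 'M[R]_n) : Prop :=
  S^T = S /\ forall x : 'rV[R]_n, x != 0 -> 0 < (x *m S *m x^T) 0 0.

Lemma quad_form_mxE (R : realType) (n : nat) (S : 'M[R]_n) (x : 'rV[R]_n) :
  (x *m S *m x^T) 0 0 = \sum_i \sum_j S i j * x 0 i * x 0 j.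
Proof.
rewrite exchange_big mxE; apply: eq_bigr => j _ /=.
rewrite !mxE mulr_suml; apply: eq_bigr => i _.
by rewrite (mulrC (S i j)).
Qed.

(** A vector in the kernel would be isotropic. *)
Lemma posdef_unitmx (R : realType) (n : nat) (S : 'M[R]_n) :
  posdefmx S -> S \in unitmx.
Proof.
case=> _ Spos; rewrite -row_free_unit; apply: inj_row_free => x xS0.
by apply/eqP/negP => /negP/Spos; rewrite xS0 mul0mx mxE ltxx.
Qed.

(** The form x S^-1 x^T is the form of S at the vector x S^-1. *)
Lemma posdef_invmx (R : realType) (n : nat) (S : 'M[R]_n) :
  posdefmx S -> posdefmx (invmx S).
Proof.
move=> Spd; have Su := posdef_unitmx Spd; case: Spd => Ssym Spos.
have Vsym : (invmx S)^T = invmx S by rewrite trmx_inv Ssym.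
split=> // x x0.
have y0 : x *m invmx S != 0.
  by apply: contraNneq x0 => /(congr1 (mulmx^~ S)) /=; rewrite mulmxKV // mul0mx => ->.
by have := Spos _ y0; rewrite trmx_mul Vsym mulmxKV // mulmxA.
Qed.

(** Row independence of M makes x |-> x M injective, so the pulled-back form
    cannot degenerate. *)
Lemma posdef_congr (R : realType) (m n : nat) (M : 'M[R]_(m, n)) (S : 'M[R]_n) :
  row_free M -> posdefmx S -> posdefmx (M *m S *m M^T).
Proof.
move=> Mfree [Ssym Spos]; split.
  by rewrite !trmx_mul trmxK Ssym mulmxA.
move=> x x0.
have y0 : x *m M != 0.
  by apply: contraNneq x0 => xM0; apply/eqP/(row_free_inj Mfree); rewrite xM0 mul0mx.
by have := Spos _ y0; rewrite trmx_mul !mulmxA.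
Qed.

Lemma metric_posdef (R : realType) (n : nat) (U : set 'rV[R]_n)
    (g : 'rV[R]_n -> 'M[R]_n) (q : 'rV[R]_n) :
  metric_on U g -> U q -> posdefmx (g q).
Proof.
by case=> _ gsym gpos Uq; split=> [|x x0]; rewrite ?quad_form_mxE; auto.
Qed.

Lemma Gup_mxE (R : realType) (n r : nat) (g : 'rV[R]_n -> 'M[R]_n)
    (C : 'I_r -> TQ R n -> R) (p : TQ R n) :
  Gup g C p = Cmx C p *m invmx (g p.1) *m (Cmx C p)^T.
Proof.
apply/matrixP => a b; rewrite [LHS]mxE exchange_big [RHS]mxE.
apply: eq_bigr => j _ /=; rewrite [in RHS]mxE [in RHS]mulr_suml.
apply: eq_bigr => i _; rewrite [(Cmx C p)^T _ _]mxE.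
by rewrite (mulrC (ginv _ _ _ _)).
Qed.

Lemma Gup_posdef (R : realType) (n r : nat) (U : set 'rV[R]_n)
    (g : 'rV[R]_n -> 'M[R]_n) (C : 'I_r -> TQ R n -> R) (p : TQ R n) :
  metric_on U g -> U p.1 -> \rank (Cmx C p) = r -> posdefmx (Gup g C p).
Proof.
move=> hg Up rkC; rewrite Gup_mxE; apply: posdef_congr.
  by rewrite /row_free rkC.
exact/posdef_invmx/(metric_posdef hg).
Qed.

(** * Tangency as a linear system for the multipliers *)

Lemma smooth_on_differentiable (R : realType) (V : normedModType R)
    (D : set V) (f : V -> R) (x : V) :
  smooth_on D f -> D x -> differentiable f x.
Proof. by move=> /(_ 1%N) [fdiff _]; exact: fdiff. Qed.

(** By linearity of the differential, expanding the vector in the coordinate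
    basis of the chart. *)
Lemma diff_chart (R : realType) (n : nat) (f : TQ R n -> R) (p v : TQ R n) :
  differentiable f p ->
  'd f p v = \sum_i v.1 0 i * partial_q f i p
             + \sum_i v.2 0 i * partial_qdot f i p.
Proof.
move=> fdiff.
have vE : v = \sum_i v.1 0 i *: ((delta_mx 0 i, 0) : TQ R n)
              + \sum_i v.2 0 i *: ((0, delta_mx 0 i) : TQ R n).
  apply: injective_projections => /=.
    rewrite !(big_morph fst (id1 := 0) (op1 := +%R)) //=.
    rewrite [X in _ = _ + X]big1 ?addr0; last by move=> i _; rewrite scaler0.
    exact: row_sum_delta.
  rewrite !(big_morph snd (id1 := 0) (op1 := +%R)) //=.
  rewrite [X in _ = X + _]big1 ?add0r; last by move=> i _; rewrite scaler0.
  exact: row_sum_delta.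
rewrite {1}vE linearD !linear_sum; congr (_ + _); apply: eq_bigr => i _.
  by rewrite linearZ /partial_q deriveE.
by rewrite linearZ /partial_qdot deriveE.
Qed.

Definition raised_col (R : realType) (n : nat) (g : 'rV[R]_n -> 'M[R]_n)
    (F : 'I_n -> TQ R n -> R) (p : TQ R n) : 'cV[R]_n :=
  \col_i raise g F i p.

(** Minus the derivative of the constraints along the motion without reactive
    forces, hence what the reactive forces have to contribute for tangency. *)
Definition neg_drift (R : realType) (n r : nat) (g : 'rV[R]_n -> 'M[R]_n)
    (A : 'I_n -> TQ R n -> R) (C : 'I_r -> TQ R n -> R) (p : TQ R n) :
    'cV[R]_r :=
  \col_b (\sum_i Cmx C p b i * (christoffel_quad g p i - raise g A i p)
          - \sum_i p.2 0 i * partial_q (C b) i p).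

Lemma raise_ideal (R : realType) (n r : nat) (g : 'rV[R]_n -> 'M[R]_n)
    (W : set (TQ R n)) (C : 'I_r -> TQ R n -> R)
    (lambda : 'I_r -> TQ R n -> R) (F : 'I_n -> TQ R n -> R) (p : TQ R n) :
  ideal_on W C lambda F -> W p ->
  raised_col g F p =
    invmx (g p.1) *m (Cmx C p)^T *m (\col_a lambda a p).
Proof.
move=> hF Wp; apply/colP => i; rewrite -mulmxA [LHS]mxE [RHS]mxE.
apply: eq_bigr => j _; rewrite hF // [in RHS]mxE; congr (_ * _).
by apply: eq_bigr => a _; rewrite [_^T _ _]mxE [(\col__ _) _ _]mxE mulrC.
Qed.

Lemma diff_dyn_field (R : realType) (n r : nat) (g : 'rV[R]_n -> 'M[R]_n)
    (A F : 'I_n -> TQ R n -> R) (C : 'I_r -> TQ R n -> R) (p : TQ R n)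
    (a : 'I_r) :
  differentiable (C a) p ->
  'd (C a) p (dyn_field g A F p) =
    (Cmx C p *m raised_col g F p) a 0 - neg_drift g A C p a 0.
Proof.
move=> Cdiff; rewrite diff_chart // mxE [neg_drift _ _ _ _ _ _]mxE opprB addrCA.
congr (_ + _); rewrite -sumrB; apply: eq_bigr => i _.
by rewrite !mxE; ring.
Qed.

(** For ideal constraints M applied to the raised reactive force is G lambda,
    so tangency sees the multipliers only through G. *)
Lemma tangent_at_linear (R : realType) (n r : nat) (g : 'rV[R]_n -> 'M[R]_n)
    (W : set (TQ R n)) (A F : 'I_n -> TQ R n -> R)
    (C : 'I_r -> TQ R n -> R) (lambda : 'I_r -> TQ R n -> R) (p : TQ R n) :
  ideal_on W C lambda F -> W p -> (forall a, differentiable (C a) p) ->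
  (forall a, 'd (C a) p (dyn_field g A F p) = 0) <->
  Gup g C p *m (\col_a lambda a p) = neg_drift g A C p.
Proof.
move=> hF Wp Cdiff.
have <- : Cmx C p *m raised_col g F p = Gup g C p *m (\col_a lambda a p).
  by rewrite (raise_ideal g hF Wp) Gup_mxE !mulmxA.
split=> [tan | eq_drift a].
  by apply/colP => a; apply/eqP; rewrite -subr_eq0 -diff_dyn_field ?tan.
by rewrite diff_dyn_field // eq_drift subrr.
Qed.

Lemma tangent_at_multipliers (R : realType) (n r : nat)
    (g : 'rV[R]_n -> 'M[R]_n) (W : set (TQ R n))
    (A F : 'I_n -> TQ R n -> R) (C : 'I_r -> TQ R n -> R)
    (lambda : 'I_r -> TQ R n -> R) (p : TQ R n) :
  ideal_on W C lambda F -> W p -> (forall a, differentiable (C a) p) ->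
  Gup g C p \in unitmx ->
  (forall a, 'd (C a) p (dyn_field g A F p) = 0) <->
  \col_a lambda a p = Gdown g C p *m neg_drift g A C p.
Proof.
move=> hF Wp Cdiff Gu; rewrite (tangent_at_linear g A hF Wp Cdiff).
split=> [<- | ->]; first by rewrite mulKmx.
by rewrite mulKVmx.
Qed.

(** * The multipliers and the reactive forces *)

Theorem theorem8p1 (R : realType) (n r : nat) (hrn : (r < n)%N)
  (U : set 'rV[R]_n) (hU : open U)
  (D : set (TQ R n)) (hD : open D) (hDU : forall p, D p -> U p.1)
  (g : 'rV[R]_n -> 'M[R]_n) (hg : metric_on U g)
  (A : 'I_n -> TQ R n -> R) (hA : forall i, smooth_on D (A i))
  (C : 'I_r -> TQ R n -> R) (hC : forall a, smooth_on D (C a))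
  (W : set (TQ R n)) (hWD : W `<=` D) (hCW : constraint_set D C `<=` W)
  (hrank : forall p, W p -> \rank (Cmx C p) = r) :
  (forall p, W p -> (Gup g C p)^T = Gup g C p /\ Gup g C p \in unitmx) /\
  (forall (lambda : 'I_r -> TQ R n -> R) (F : 'I_n -> TQ R n -> R),
    ideal_on W C lambda F ->
    (tangent_on W C (dyn_field g A F) <->
      (forall p, W p -> forall a,
        lambda a p =
          \sum_b Gdown g C p a b *
            (\sum_i Cmx C p b i * (christoffel_quad g p i - raise g A i p)
             - \sum_i p.2 0 i * partial_q (C b) i p))) /\
    (tangent_on W C (dyn_field g A F) ->
      (forall p, W p -> forall i,
        raise g F i p =
          \sum_a \sum_b Gdown g C p a b * Craised g C p a i *
            (\sum_j Cmx C p b j * (christoffel_quad g p j - raise g A j p)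
             - \sum_j p.2 0 j * partial_q (C b) j p)))).
Proof.
have Gpd p : W p -> posdefmx (Gup g C p).
  by move=> Wp; apply: (Gup_posdef hg); [exact/hDU/hWD | exact: hrank].
split=> [p Wp | lambda F hF].
  by split; [case: (Gpd p Wp) | exact/posdef_unitmx/Gpd].
have solve p : W p ->
    (forall a, 'd (C a) p (dyn_field g A F p) = 0) <->
    \col_a lambda a p = Gdown g C p *m neg_drift g A C p.
  move=> Wp; have Cdiff a : differentiable (C a) p.
    exact: smooth_on_differentiable (hC a) (hWD _ Wp).
  exact: (tangent_at_multipliers A hF Wp Cdiff (posdef_unitmx (Gpd p Wp))).
split; first split=> [tan p Wp a | hlam p Wp].
- have /solve/colP/(_ a) := tan p Wp => /(_ Wp).
  rewrite !mxE => ->; by apply: eq_bigr => b _; rewrite [neg_drift _ _ _ _ _ _]mxE.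
- apply/(solve p Wp)/colP => a; rewrite !mxE hlam //.
  by apply: eq_bigr => b _; rewrite [neg_drift _ _ _ _ _ _]mxE.
move=> tan p Wp i.
have /colP/(_ i) := raise_ideal g hF Wp.
rewrite (iffLR (solve p Wp) (tan p Wp)) mxE => ->.
rewrite mxE; apply: eq_bigr => a _.
rewrite [X in _ * X]mxE mulr_sumr; apply: eq_bigr => b _.
rewrite [neg_drift _ _ _ _ _ _]mxE mulrA; congr (_ * _).
rewrite mulrC; congr (_ * _).
by rewrite mxE; apply: eq_bigr => j _; rewrite [_^T _ _]mxE.
Qed.
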